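(* Assume the standing hypotheses on $H$ (Conditions A, B, C, in particular $\Lambda^{\sup}<\infty$) and suppose $k>1$ (equivalently $\gamma>2$). Let $0<T<\infty$, let $h:\mathbb{R}^n\to\mathbb{R}$ be continuous with $\sup_{\mathbb{R}^n}h<\infty$, let $\chi:(0,T)\to\mathbb{R}$ be bounded and continuous, let $\sigma\ge 0$, and for some $m\in\mathbb{R}$ let $Z:[m,\infty)\to[0,\infty)$ be non-increasing and continuous. Let $u$ be upper semicontinuous on $\mathbb{R}^n\times[0,T)$ with $\inf u>m$, be a viscosity sub-solution of $\mathcal{P}_\sigma(t,u,u_t,Du,D^2u)\ge 0$ in $\mathbb{R}^n_T$, and satisfy $u(x,0)\le h(x)$ for all $x\in\mathbb{R}^n$. Fix $z\in\mathbb{R}^n$ and suppose $\sup_{B^R_T}u=o(R^{\beta})$ as $R\to\infty$. (a) If $0\le\sigma\le\gamma/2$ and $\beta=\gamma^*$, then for all $(x,t)\in\mathbb{R}^n_T$: $u(x,t)\le \sup_{\mathbb{R}^n}h+t\sup_{(0,T)}|\chi|$ when $\sigma=0$, and $u(x,t)\le\sup_{\mathbb{R}^n}h$ when $0<\sigma\le\gamma/2$. (b) If $\sigma>\gamma/2$ and $\beta=\sigma^*$, then $u(x,t)\le\sup_{\mathbb{R}^n}h$ for all $(x,t)\in\mathbb{R}^n_T$.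
   Context: Let $n\ge2$, let $S^{n\times n}$ denote the real symmetric $n\times n$ matrices with the usual partial order, $I$ the identity, $O$ the zero matrix, and for a unit vector $e$ let $(e\otimes e)_{ij}=e_ie_j$ (more generally $(p\otimes q)_{ij}=p_iq_j$). $H:\mathbb{R}^n\times S^{n\times n}\to\mathbb{R}$ is continuous and satisfies: Condition A: $H(q,X)\le H(q,Y)$ whenever $X\le Y$, and $H(q,O)=0$ for all $q$. Condition B: there is $k_1\ge0$ with $H(\theta q,X)=|\theta|^{k_1}H(q,X)$ for all $\theta\in\mathbb{R}$ and $H(q,\theta X)=\theta H(q,X)$ for all $\theta>0$. Condition C: $\max_{|e|=1}H(e,-I)<0<\min_{|e|=1}H(e,I)$ and $\Lambda^{\sup}:=\sup_{\lambda\in\mathbb{R}}\max_{|e|=1}H(e,\lambda e\otimes e+I)<\infty$. Set $k=k_1+1$, $\gamma=k+1$, and for $k>1$, $\gamma^*=\gamma/(\gamma-2)$; for $\sigma>1$, $\sigma^*=\sigma/(\sigma-1)$. $\mathbb{R}^n_T=\mathbb{R}^n\times(0,T)$, and for fixed $z$, $B^R_T=\{(x,t):|x-z|\le R,\ 0<t<T\}$. The operator is $\mathcal{P}_\sigma(t,u,u_t,Du,D^2u)=H(Du,D^2u+Z(u)Du\otimes Du)+\chi(t)|Du|^\sigma-u_t$, with the convention $|q|^0=1$. Solutions, sub-solutions and super-solutions are in the viscosity sense. *)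

(* Defs.v *)
From Stdlib Require Import Reals.
From mathcomp Require Import ssreflect ssrbool eqtype ssrnat fintype bigop.
Set Implicit Arguments.
Unset Strict Implicit.
Unset Printing Implicit Defensive.

Open Scope R_scope.

Definition vecn (n : nat) := 'I_n -> R.
Definition matn (n : nat) := 'I_n -> 'I_n -> R.

Definition vsum n (f : 'I_n -> R) : R := \big[Rplus/0%R]_(i < n) f i.

Definition vadd n (x y : vecn n) : vecn n := fun i => x i + y i.
Definition vsub n (x y : vecn n) : vecn n := fun i => x i - y i.
Definition vscal n (a : R) (x : vecn n) : vecn n := fun i => a * x i.
Definition vnorm n (x : vecn n) : R := sqrt (vsum (fun i => x i * x i)).
Definition basis n (i : 'I_n) : vecn n := fun j => if i == j then 1 else 0.

Definition madd n (X Y : matn n) : matn n := fun i j => X i j + Y i j.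
Definition mscal n (a : R) (X : matn n) : matn n := fun i j => a * X i j.
Definition mopp n (X : matn n) : matn n := fun i j => - X i j.
Definition mid n : matn n := fun i j => if i == j then 1 else 0.
Definition mzero n : matn n := fun _ _ => 0.
Definition outer n (p q : vecn n) : matn n := fun i j => p i * q j.
Definition symmetric n (X : matn n) : Prop := forall i j, X i j = X j i.
Definition qform n (X : matn n) (xi : vecn n) : R :=
  vsum (fun i => vsum (fun j => xi i * X i j * xi j)).
Definition mle n (X Y : matn n) : Prop := forall xi, qform X xi <= qform Y xi.
Definition mdist n (X Y : matn n) : R :=
  sqrt (vsum (fun i => vsum (fun j => (X i j - Y i j) ^ 2))).

(* a^b for a >= 0, b >= 0, with the convention a^0 = 1 (also for a = 0) *)
Definition rpow (a b : R) : R :=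
  if Req_EM_T a 0 then (if Req_EM_T b 0 then 1 else 0) else Rpower a b.

Definition H_continuous n (H : vecn n -> matn n -> R) : Prop :=
  forall q X, symmetric X -> forall eps, 0 < eps -> exists delta, 0 < delta /\
    forall q' X', symmetric X' -> vnorm (vsub q' q) < delta -> mdist X' X < delta ->
      Rabs (H q' X' - H q X) < eps.

Definition condA n (H : vecn n -> matn n -> R) : Prop :=
  (forall q X Y, symmetric X -> symmetric Y -> mle X Y -> H q X <= H q Y) /\
  (forall q, H q (@mzero n) = 0).

Definition condB n (H : vecn n -> matn n -> R) (k1 : R) : Prop :=
  0 <= k1 /\
  (forall theta q X, symmetric X -> H (vscal theta q) X = rpow (Rabs theta) k1 * H q X) /\
  (forall theta q X, symmetric X -> 0 < theta -> H q (mscal theta X) = theta * H q X).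

Definition unit_vec n (e : vecn n) : Prop := vnorm e = 1.

Definition condC n (H : vecn n -> matn n -> R) : Prop :=
  (exists M, is_lub (fun y => exists e, unit_vec e /\ y = H e (mopp (@mid n))) M
             /\ M < 0) /\
  (* 0 < min_{|e|=1} H(e,I) *)
  (exists M, is_lub (fun y => exists e, unit_vec e /\ y = - H e (@mid n)) M
             /\ - M > 0) /\
  (* Lambda^sup := sup_lambda max_{|e|=1} H(e, lambda e(x)e + I) < infinity *)
  (exists L, forall lambda e, unit_vec e ->
      H e (madd (mscal lambda (outer e e)) (@mid n)) <= L).

Definition jcont n (f : vecn n -> R -> R) : Prop :=
  forall x t eps, 0 < eps -> exists delta, 0 < delta /\
    forall y s, vnorm (vsub y x) < delta -> Rabs (s - t) < delta ->
      Rabs (f y s - f x t) < eps.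

Definition C21 n (phi : vecn n -> R -> R) (phit : vecn n -> R -> R)
  (Dphi : vecn n -> R -> vecn n) (D2phi : vecn n -> R -> matn n) : Prop :=
  (forall x t, derivable_pt_lim (fun s => phi x s) t (phit x t)) /\
  (forall i x t, derivable_pt_lim (fun s => phi (vadd x (vscal s (basis i))) t) 0
                   (Dphi x t i)) /\
  (forall i j x t, derivable_pt_lim
                   (fun s => Dphi (vadd x (vscal s (basis i))) t j) 0 (D2phi x t i j)) /\
  jcont phi /\ jcont phit /\ (forall i, jcont (fun x t => Dphi x t i)) /\
  (forall i j, jcont (fun x t => D2phi x t i j)).

Definition Psigma n (H : vecn n -> matn n -> R) (Z chi : R -> R) (sigma : R)
  (t r a : R) (p : vecn n) (X : matn n) : R :=
  H p (madd X (mscal (Z r) (outer p p))) + chi t * rpow (vnorm p) sigma - a.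

Definition visc_subsol n (H : vecn n -> matn n -> R) (Z chi : R -> R) (sigma T : R)
  (u : vecn n -> R -> R) : Prop :=
  forall phi phit Dphi D2phi x0 t0,
    C21 phi phit Dphi D2phi -> 0 < t0 < T ->
    (exists r, 0 < r /\ forall y s, vnorm (vsub y x0) < r -> Rabs (s - t0) < r ->
        0 < s < T -> u y s - phi y s <= u x0 t0 - phi x0 t0) ->
    0 <= Psigma H Z chi sigma t0 (u x0 t0) (phit x0 t0) (Dphi x0 t0) (D2phi x0 t0).

Definition usc_on n (T : R) (u : vecn n -> R -> R) : Prop :=
  forall x t, 0 <= t < T -> forall eps, 0 < eps -> exists delta, 0 < delta /\
    forall y s, 0 <= s < T -> vnorm (vsub y x) < delta -> Rabs (s - t) < delta ->
      u y s < u x t + eps.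

(* Main.v *)
Require Import Defs.
From HB Require Import structures.
From Stdlib Require Import Reals Lra FunctionalExtensionality Classical.
From mathcomp Require Import ssreflect ssrfun ssrbool eqtype ssrnat seq fintype bigop.
From Coquelicot Require Import Coquelicot.
Open Scope R_scope.

(** Compare [u] with
    [Sh + A(t) (1 + |x - z|^2)^(beta/2) + (kappa + eta) t + exp (N (t - T1))],
    where [A(t) = al (1 + t/T)] and [kappa] is [sup |chi|] if [sigma = 0] and [0]
    otherwise. For such a radial function [Lambda^sup] bounds the [H] term by a
    multiple of [A^(k1+1) (1 + |x - z|^2)^(beta/2)]; with [q = gamma/2 > 1] the
    sum of the [H] and [chi] terms is at most
    [kappa + eta + C A^q (1 + |x - z|^2)^(beta/2)], and [C A^q <= al/T = A'] once
    [al] is small. The growth condition keeps a maximum of the difference in a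
    bounded set, and the exponential, which is tiny for [t < T1] but huge for
    [t] beyond [T1] when [N] is large, keeps it away from [t = T]. Finally
    [N -> oo], [al -> 0], [eta -> 0]. *)

(** * Finite sums and the Euclidean norm *)

HB.instance Definition _ := Monoid.isComLaw.Build R 0 Rplus
  (fun x y z => Logic.eq_sym (Rplus_assoc x y z)) Rplus_comm Rplus_0_l.

Lemma vsumD n (f g : 'I_n -> R) :
  vsum (fun i => f i + g i) = vsum f + vsum g.
Proof. exact: big_split. Qed.

Lemma vsumZ n c (f : 'I_n -> R) : vsum (fun i => c * f i) = c * vsum f.
Proof.
apply: (big_ind2 (fun a b => a = c * b)) => //; first by lra.
by move=> ? ? ? ? -> ->; lra.
Qed.

Lemma vsum_delta n (i : 'I_n) (f : 'I_n -> R) :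
  vsum (fun j => if i == j then f j else 0) = f i.
Proof.
rewrite /vsum (bigD1 i) //= eqxx big1 ?Rplus_0_r // => j /negbTE.
by rewrite eq_sym => ->.
Qed.

Lemma vsum_ge0 n (f : 'I_n -> R) : (forall i, 0 <= f i) -> 0 <= vsum f.
Proof. by move=> f0; apply: big_ind => // *; lra. Qed.

Lemma vsum_ge_term n (f : 'I_n -> R) i : (forall i, 0 <= f i) -> f i <= vsum f.
Proof.
move=> f0; have -> : vsum f = f i + \big[Rplus/0]_(j < n | j != i) f j.
  exact: bigD1.
have : 0 <= \big[Rplus/0]_(j < n | j != i) f j.
  by apply: big_ind => // *; lra.
by lra.
Qed.

Lemma vsum_le_const n (f : 'I_n -> R) c :
  (forall i, f i <= c) -> vsum f <= INR n * c.
Proof.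
elim: n f => [|n IH] f fc; first by rewrite /vsum big_ord0 Rmult_0_l; exact: Rle_refl.
rewrite /vsum big_ord_recr S_INR.
have := IH _ (fun i => fc (widen_ord (leqnSn n) i)).
by have := fc ord_max; rewrite /vsum /=; lra.
Qed.

Definition vsq n (y : vecn n) : R := vsum (fun i => y i * y i).

Lemma vsq_ge0 n (y : vecn n) : 0 <= vsq n y.
Proof. by apply: vsum_ge0 => i; nra. Qed.

Lemma vnorm_ge0 n (y : vecn n) : 0 <= vnorm y.
Proof. exact: sqrt_pos. Qed.

Lemma vnorm_sqr n (y : vecn n) : vnorm y * vnorm y = vsq n y.
Proof. by apply: sqrt_sqrt; exact: vsq_ge0. Qed.

Lemma coord_le_vnorm n (y : vecn n) i : Rabs (y i) <= vnorm y.
Proof.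
rewrite -sqrt_Rsqr_abs; apply: sqrt_le_1_alt.
by apply: (vsum_ge_term _ (fun j => y j * y j)) => j; nra.
Qed.

Lemma vnorm_lt_coord n (y : vecn n) eps : 0 < eps ->
  (forall i, Rabs (y i) < eps / (INR n + 1)) -> vnorm y < eps.
Proof.
move=> eps0 yi; have n0 := pos_INR n.
have d0 : 0 < eps / (INR n + 1) by apply: Rdiv_lt_0_compat; lra.
have epsE : eps = (INR n + 1) * (eps / (INR n + 1)) by field; lra.
(* The squared norm is at most [n d^2], which is below [((n + 1) d)^2 = eps^2]. *)
set d := eps / _ in yi d0 epsE.
have : vsq n y <= INR n * (d * d).
  apply: vsum_le_const => i; have := yi i.
  by move=> /Rabs_def2[]; nra.
rewrite -vnorm_sqr; have := vnorm_ge0 n y => ? ?.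
by apply: Rnot_le_lt => ?; nra.
Qed.

Lemma vsq_scal n c (y : vecn n) : vsq n (vscal c y) = c * c * vsq n y.
Proof. by rewrite /vsq -vsumZ; apply: eq_bigr => i _; rewrite /vscal; lra. Qed.

Lemma vnorm_scal n c (y : vecn n) : 0 <= c -> vnorm (vscal c y) = c * vnorm y.
Proof.
move=> c0; rewrite /vnorm -!/(vsq _ _) vsq_scal sqrt_mult ?sqrt_square //.
  by nra.
exact: vsq_ge0.
Qed.

(** Only the [i]-th summand depends on [s], so partial derivatives of radial functions reduce to the
    derivative of an explicit quadratic in [s]. *)
Lemma vsq_line n (x z : vecn n) i s :
  vsq n (vsub (vadd x (vscal s (basis i))) z) =
  vsq n (vsub x z) + (2 * (x i - z i) * s + s * s).
Proof.
rewrite -(vsum_delta _ i (fun j => 2 * (x j - z j) * s + s * s)) /vsq -vsumD.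
by apply: eq_bigr => j _; rewrite /vsub /vadd /vscal /basis; case: eqP => _; lra.
Qed.

(** * Compactness by grills, and maxima of upper semicontinuous functions *)

(* A grill is the dual of a filter: if a set splits in two, one piece is large.
   Cluster points of grills replace subsequence extraction. *)
Section Grill.

Variables (X : Type) (Q : (X -> Prop) -> Prop).

Definition grill :=
  (forall S S' : X -> Prop, (forall p, S p -> S' p) -> Q S -> Q S') /\
  (forall S S' : X -> Prop, Q (fun p => S p \/ S' p) -> Q S \/ Q S').

(** The cluster value is the supremum of the levels [c] whose superlevel set in [K] is large: a
    superlevel set slightly below it is large, one above it is not, so the slice between them must
    be large. *)
Lemma grill_cluster_point (K : X -> Prop) (f : X -> R) a b :
  grill -> Q K -> (forall p, K p -> a <= f p <= b) ->
  exists y, forall eps, 0 < eps -> Q (fun p => K p /\ Rabs (f p - y) < eps).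
Proof.
case=> Qmono QU QK fK.
have Qbnd c : Q (fun p => K p /\ c <= f p) -> c <= b \/ Q (fun _ => False).
  move=> Qc; case: (Rle_lt_dec c b) => [|bc]; [by left | right].
  by apply: Qmono Qc => p [/fK ? ?]; lra.
have [QF|NQF] := classic (Q (fun _ => False)).
  (* If the empty set is large then every set is, and any value will do. *)
  by exists 0 => eps _; apply: Qmono QF.
have [||y [yub ylub]] := completeness (fun c => Q (fun p => K p /\ c <= f p)).
- by exists b => c /Qbnd [].
- by exists a; apply: Qmono QK => p Kp; split => //; have := fK p Kp; lra.
exists y => eps eps0.
have [c [yc Qc]] : exists c, y - eps < c /\ Q (fun p => K p /\ c <= f p).
  apply: NNPP => Nc; have : y <= y - eps; last by lra.
  apply: ylub => c Qc; apply: Rnot_lt_le => ?; apply: Nc; by exists c.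
have := QU (fun p => K p /\ y + eps / 2 <= f p)
  (fun p => K p /\ Rabs (f p - y) < eps); case=> //.
  apply: Qmono Qc => p [Kp cp].
  case: (Rle_lt_dec (y + eps / 2) (f p)) => ?; [by left | right; split=> //].
  by apply: Rabs_def1; lra.
by move=> /yub; lra.
Qed.

End Grill.

(** Restricting largeness to all neighbourhoods of a level of [f] keeps it a grill: if both pieces
    failed, at radii [e1] and [e2], the union would fail at the smaller radius. This lets several
    coordinates be treated one after the other. *)
Lemma grill_localize (X : Type) (Q : (X -> Prop) -> Prop) (f : X -> R) y :
  grill X Q -> grill X (fun S => forall eps, 0 < eps ->
                     Q (fun p => S p /\ Rabs (f p - y) < eps)).
Proof.
case=> Qmono QU; split=> [S S' SS' QS eps eps0|S S' QSS'].
  by apply: Qmono (QS _ eps0) => p [/SS'].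
apply: NNPP => /not_or_and [] /not_all_ex_not [e1 N1] /not_all_ex_not [e2 N2].
have [e1_0 {}N1] := imply_to_and _ _ N1.
have [e2_0 {}N2] := imply_to_and _ _ N2.
have [|H|H] := QU (fun p => S p /\ Rabs (f p - y) < e1)
  (fun p => S' p /\ Rabs (f p - y) < e2); last 2 first.
- exact: N1.
- exact: N2.
apply: Qmono (QSS' (Rmin e1 e2) (Rmin_pos _ _ e1_0 e2_0)) => p [].
move=> SS' ?; have := Rmin_l e1 e2; have := Rmin_r e1 e2 => ? ?.
by case: SS' => ?; [left|right]; split=> //; lra.
Qed.

(** Induction on the list of indices: find a cluster value of one coordinate, localize the grill
    there, and continue with the remaining coordinates. *)
Lemma grill_cluster_points (I : finType) (X : Type) (f : I -> X -> R)
    (a b : I -> R) (K : X -> Prop) (Q : (X -> Prop) -> Prop) :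
  grill X Q -> Q K -> (forall i p, K p -> a i <= f i p <= b i) ->
  exists y : I -> R, forall eps, 0 < eps ->
    Q (fun p => K p /\ forall i, Rabs (f i p - y i) < eps).
Proof.
move=> gQ QK fK.
suff [y Qy] : exists y : I -> R, forall eps, 0 < eps ->
    Q (fun p => K p /\ forall i, i \in enum I -> Rabs (f i p - y i) < eps).
  exists y => eps /Qy; apply: (proj1 gQ) => p [Kp H]; split=> // i.
  by apply: H; rewrite mem_enum.
elim: (enum I) Q gQ QK => [|i l IH] Q gQ QK.
  by exists (fun _ => 0) => eps _; apply: (proj1 gQ) QK => p Kp; split.
have [y Qy] := grill_cluster_point X Q K (f i) _ _ gQ QK (fK i).
have [ys Qys] := IH _ (grill_localize X Q (f i) y gQ) Qy.
exists (fun j => if j == i then y else ys j) => eps eps0.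
apply: (proj1 gQ) (Qys _ eps0 _ eps0) => p [[Kp Hl] Hi]; split=> // j.
by rewrite inE; case: eqP => [->|_ /Hl].
Qed.


(** Every value on the cylinder is dominated by values taken arbitrarily close to a cluster point
    [(x0, t0)], and upper semicontinuity passes the bound to that point. Taking [T2 < T] puts [t0]
    where semicontinuity is available; the point [(x1, t1)] shows that the cylinder is nonempty. *)
Lemma usc_max_on_cylinder n T T2 B (u Psi : vecn n -> R -> R) (z x1 : vecn n) t1 :
  0 < T2 < T -> usc_on T u -> jcont Psi ->
  vnorm (vsub x1 z) <= B -> 0 <= t1 <= T2 ->
  exists x0 t0, 0 <= t0 <= T2 /\ forall y s, vnorm (vsub y z) <= B ->
    0 <= s <= T2 -> u y s - Psi y s <= u x0 t0 - Psi x0 t0.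
Proof.
move=> [T20 T2T] uscu cPsi x1B t1T2.
pose F (p : vecn n * R) := u p.1 p.2 - Psi p.1 p.2.
pose K (p : vecn n * R) := vnorm (vsub p.1 z) <= B /\ 0 <= p.2 <= T2.
(* [S] is large if [F] is dominated on [K] by its values on [S]. *)
pose Q S := forall p, K p -> exists p', S p' /\ F p <= F p'.
have gQ : grill _ Q.
  split=> [S S' SS' QS p /QS [p' [/SS' ? ?]]|S S' QSS']; first by exists p'.
  apply: NNPP => /not_or_and [] /not_all_ex_not [p1 N1] /not_all_ex_not [p2 N2].
  have [K1 {}N1] := imply_to_and _ _ N1; have [K2 {}N2] := imply_to_and _ _ N2.
  (* Whatever dominates the larger of the two values dominates both, and it lies in [S] or in [S'],
     contrary to [N1] or [N2]. *)
  have [F12|F21] := Rle_lt_dec (F p1) (F p2).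
    have [p [[Sp|Sp] ?]] := QSS' p2 K2; [apply: N1|apply: N2]; exists p; split=> //.
    by lra.
  have [p [[Sp|Sp] ?]] := QSS' p1 K1; [apply: N1|apply: N2]; exists p; split=> //.
  by lra.
(* The index [None] stands for the time coordinate. *)
pose f (o : option 'I_n) (p : vecn n * R) := if o is Some i then p.1 i else p.2.
pose a (o : option 'I_n) := if o is Some i then z i - B else 0.
pose b (o : option 'I_n) := if o is Some i then z i + B else T2.
have QK : Q K by move=> p Kp; exists p; split=> //; lra.
have fK o p : K p -> a o <= f o p <= b o.
  case: o => [i|] [Kp ?] //=.
  have /Rabs_le_between : Rabs (p.1 i - z i) <= B; last by lra.
  exact: Rle_trans (coord_le_vnorm n (vsub p.1 z) i) Kp.
have [y Qy] := grill_cluster_points _ _ _ _ _ K Q gQ QK fK.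
pose x0 : vecn n := fun i => y (Some i); pose t0 := y None.
have n0 := pos_INR n.
have near eps : 0 < eps -> Q (fun p => K p /\ vnorm (vsub p.1 x0) < eps /\
                                     Rabs (p.2 - t0) < eps).
  move=> eps0; have e0 : 0 < eps / (INR n + 1) by apply: Rdiv_lt_0_compat; lra.
  have e1 : eps / (INR n + 1) <= eps.
    by apply/Rle_div_l; nra.
  apply: (proj1 gQ) (Qy _ e0) => p [Kp Hp]; split=> //; split.
    by apply: vnorm_lt_coord => // i; exact: (Hp (Some i)).
  by have := Hp None; rewrite /= -/t0; lra.
have K1 : K (x1, t1) by [].
have t0T2 : 0 <= t0 <= T2.
  split; apply: Rnot_lt_le => Nt.
    have e0 : 0 < - t0 by lra.
    have [p [[[_ ?] [_ /Rabs_def2 ?]] _]] := near _ e0 _ K1; lra.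
  have e0 : 0 < t0 - T2 by lra.
  have [p [[[_ ?] [_ /Rabs_def2 ?]] _]] := near _ e0 _ K1; lra.
exists x0, t0; split=> // y' s yB sT2.
apply: le_epsilon => eps eps0; have e2 : 0 < eps / 2 by lra.
have t0T : 0 <= t0 < T by lra.
have [d1 [d10 ud1]] := uscu x0 t0 t0T _ e2.
have [d2 [d20 Pd2]] := cPsi x0 t0 _ e2.
have [p [[[_ pT] [px pt]] Fp]] := near _ (Rmin_pos _ _ d10 d20) (y', s) (conj yB sT2).
have ? := Rmin_l d1 d2; have ? := Rmin_r d1 d2.
have := ud1 p.1 p.2; have := Pd2 p.1 p.2.
move=> /(_ ltac:(lra) ltac:(lra)) /Rabs_def2 ? /(_ ltac:(lra) ltac:(lra) ltac:(lra)).
by rewrite /F /= in Fp; lra.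
Qed.

(** * Joint continuity in space and time *)

Lemma jcont_const n c : jcont (fun (_ : vecn n) _ => c).
Proof.
by move=> x t eps eps0; exists 1; split=> [|y s _ _]; rewrite ?Rminus_diag ?Rabs_R0; lra.
Qed.

Lemma jcont_time n : jcont (fun (_ : vecn n) t => t).
Proof. by move=> x t eps eps0; exists eps. Qed.

Lemma jcont_coord n i : jcont (fun (x : vecn n) _ => x i).
Proof.
move=> x t eps eps0; exists eps; split=> // y s yx _.
exact: Rle_lt_trans (coord_le_vnorm n (vsub y x) i) yx.
Qed.

Lemma jcont_comp n (g : R -> R) (f : vecn n -> R -> R) :
  jcont f -> (forall x t, continuity_pt g (f x t)) -> jcont (fun x t => g (f x t)).
Proof.
move=> cf cg x t eps eps0; have [d [d0 gd]] := cg x t eps eps0.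
have [d' [d'0 fd']] := cf x t d d0.
exists d'; split=> // y s yx st.
(* [continuity_pt] speaks only of points different from the base point, so equal values are treated
   apart. *)
have [->|ne] := Req_dec (f y s) (f x t); first by rewrite Rminus_diag Rabs_R0.
apply: gd; split; first by split=> //; exact: not_eq_sym.
exact: fd'.
Qed.

Lemma jcont_plus n (f g : vecn n -> R -> R) :
  jcont f -> jcont g -> jcont (fun x t => f x t + g x t).
Proof.
move=> cf cg x t eps eps0; have e2 : 0 < eps / 2 by lra.
have [d [d0 fd]] := cf x t _ e2; have [d' [d'0 gd']] := cg x t _ e2.
exists (Rmin d d'); split=> [|y s yx st]; first exact: Rmin_pos.
have ? := Rmin_l d d'; have ? := Rmin_r d d'.
have := fd y s ltac:(lra) ltac:(lra); have := gd' y s ltac:(lra) ltac:(lra).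
by move=> /Rabs_def2 ? /Rabs_def2 ?; apply: Rabs_def1; lra.
Qed.

Lemma jcont_scal n c (f : vecn n -> R -> R) : jcont f -> jcont (fun x t => c * f x t).
Proof.
move=> cf; apply: (jcont_comp n (fun r => c * r)) => // x t.
by apply: continuity_pt_scal; exact: derivable_continuous_pt (derivable_pt_id _).
Qed.

(** Polarization, [f g = ((f + g)^2 - (f - g)^2) / 4], reduces products to squares, which are
    compositions with a function of one variable. *)
Lemma jcont_mult n (f g : vecn n -> R -> R) :
  jcont f -> jcont g -> jcont (fun x t => f x t * g x t).
Proof.
have jcont_sqr (k : vecn n -> R -> R) : jcont k -> jcont (fun x t => k x t * k x t).
  move=> ck; apply: (jcont_comp n (fun r => r * r)) => // x t.
  by apply: continuity_pt_mult; exact: derivable_continuous_pt (derivable_pt_id _).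
move=> cf cg.
have := jcont_plus _ _ _ (jcont_scal _ (/ 4) _ (jcont_sqr _ (jcont_plus _ _ _ cf cg)))
  (jcont_scal _ (- / 4) _ (jcont_sqr _ (jcont_plus _ _ _ cf (jcont_scal _ (-1) _ cg)))).
move=> cfg x t eps /(cfg x t) [d [d0 Hd]]; exists d; split=> // y s yx st.
by have := Hd y s yx st; congr (Rabs _ < _); lra.
Qed.

Lemma jcont_vsum n (f : 'I_n -> vecn n -> R -> R) :
  (forall i, jcont (f i)) -> jcont (fun x t => vsum (fun i => f i x t)).
Proof.
move=> cf; rewrite /vsum; elim: (index_enum _) => [|i l IH].
  move=> x t eps /(jcont_const n 0 x t) [d [d0 Hd]]; exists d; split=> // y s yx st.
  by rewrite !big_nil; exact: (Hd y s).
move=> x t eps /(jcont_plus _ _ _ (cf i) IH x t) [d [d0 Hd]]; exists d; split=> // y s yx st.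
by rewrite !big_cons; exact: (Hd y s).
Qed.

(** * The barrier and its derivatives *)

Lemma Rpower_gt0 s b : 0 < Rpower s b.
Proof. exact: exp_pos. Qed.

Lemma Rpower_pred s b : 0 < s -> Rpower s b = s * Rpower s (b - 1).
Proof. by move=> s0; rewrite -{2}(Rpower_1 s) // -Rpower_plus; congr Rpower; lra. Qed.

Lemma is_derive_Rpower s b : 0 < s ->
  is_derive (fun r => Rpower r b) s (b * Rpower s (b - 1)).
Proof.
move=> s0; apply/is_derive_Reals; exact: derivable_pt_lim_power.
Qed.

Lemma is_derive_eq (f : R -> R) x l l' :
  is_derive f x l -> l = l' -> is_derive f x l'.
Proof. by move=> ? <-. Qed.

Section Barrier.

Variables (n : nat) (z : vecn n) (b al al' L N T1 : R).

(** A smooth substitute for [|x - z|^(2c)]; its base is at least 1, so it is differentiable at [z]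
    and monotone in [c]. *)
Definition jpow (c : R) (x : vecn n) : R := Rpower (1 + vsq n (vsub x z)) c.

Definition barrier (x : vecn n) (t : R) : R :=
  (al + al' * t) * jpow b x + (L * t + exp (N * (t - T1))).

Definition barrier_t (x : vecn n) (t : R) : R :=
  al' * jpow b x + (L + N * exp (N * (t - T1))).

Definition barrier_D (x : vecn n) (t : R) : vecn n :=
  vscal ((al + al' * t) * (2 * b * jpow (b - 1) x)) (vsub x z).

(** The Hessian is kept as a multiple of the identity plus a rank-one radial term, with the first
    coefficient equal to the one in [barrier_D]; this is the shape [radial_bound] asks for. *)
Definition barrier_D2 (x : vecn n) (t : R) : matn n := fun i j =>
  (al + al' * t) * (2 * b * jpow (b - 1) x) * mid i j +
  (al + al' * t) * (2 * b * (2 * (b - 1) * jpow (b - 2) x)) *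
    (vsub x z i * vsub x z j).

Lemma is_derive_jpow c (x : vecn n) i :
  is_derive (fun s => jpow c (vadd x (vscal s (basis i)))) 0
    (2 * c * jpow (c - 1) x * vsub x z i).
Proof.
apply: (is_derive_ext (fun s =>
   Rpower (1 + (vsq n (vsub x z) + (2 * (x i - z i) * s + s * s))) c)).
  by move=> s; rewrite /jpow vsq_line.
have q0 := vsq_ge0 n (vsub x z).
have -> : 2 * c * jpow (c - 1) x * vsub x z i =
   (2 * (x i - z i)) *
   (c * Rpower (1 + (vsq n (vsub x z) + (2 * (x i - z i) * 0 + 0 * 0))) (c - 1)).
  rewrite /jpow /vsub -/(vsub x z).
  rewrite (_ : 2 * (x i - z i) * 0 + 0 * 0 = 0); last by lra.
  by rewrite Rplus_0_r; lra.
apply: (is_derive_comp (fun r => Rpower r c)).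
  by apply: is_derive_Rpower; lra.
by auto_derive => //; lra.
Qed.

Lemma is_derive_basis i j (x : vecn n) :
  is_derive (fun s => vadd x (vscal s (basis i)) j - z j) 0 (mid i j).
Proof. by rewrite /vadd /vscal /basis /mid; auto_derive => //; lra. Qed.

Lemma jcont_jpow c : jcont (fun x _ => jpow c x).
Proof.
apply: (jcont_comp n (fun s => Rpower s c)
          (fun x _ => 1 + vsum (fun i => (x i + - z i) * (x i + - z i)))) => [|x t].
  apply: jcont_plus; first exact: jcont_const.
  by apply: jcont_vsum => i; apply: jcont_mult; apply: jcont_plus;
    first [exact: jcont_coord | exact: jcont_const].
apply: derivable_continuous_pt; exists (c * Rpower (1 + vsq n (vsub x z)) (c - 1)).
apply: derivable_pt_lim_power.
change (0 < 1 + vsq n (vsub x z)).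
by have ? := vsq_ge0 n (vsub x z); lra.
Qed.

Lemma jcont_exp_time : jcont (fun (_ : vecn n) t => exp (N * (t - T1))).
Proof.
apply: (jcont_comp n (fun s => exp (N * (s - T1))) (fun _ t => t)); first exact: jcont_time.
move=> x t; apply: derivable_continuous_pt; exists (N * exp (N * (t - T1))).
by apply/is_derive_Reals; auto_derive => //; rewrite /Rminus; ring.
Qed.

Lemma jcont_amplitude : jcont (fun (_ : vecn n) t => al + al' * t).
Proof.
by apply: jcont_plus; [exact: jcont_const | apply: jcont_scal; exact: jcont_time].
Qed.

Lemma barrier_C21 : C21 barrier barrier_t barrier_D barrier_D2.
Proof.
have cA := jcont_amplitude; have cE := jcont_exp_time.
have cB := jcont_jpow; have cC := jcont_const n.
have cS := jcont_scal n; have cD i : jcont (fun (x : vecn n) (_ : R) => vsub x z i).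
  by apply: jcont_plus; [exact: jcont_coord | exact: jcont_const].
split; [|split; [|split; [|split; [|split; [|split]]]]].
- move=> x t; apply/is_derive_Reals; rewrite /barrier /barrier_t.
  by auto_derive => //; rewrite /Rminus; ring.
- move=> i x t; apply/is_derive_Reals; rewrite /barrier /barrier_D /vscal.
  have H := is_derive_jpow b x i.
  apply: (is_derive_eq _ _ _ _ (is_derive_plus _ _ _ _ _
    (is_derive_scal _ _ (al + al' * t) _ H)
    (is_derive_const (L * t + exp (N * (t - T1))) 0))).
  by rewrite /plus /zero /=; ring.
- move=> i j x t; apply/is_derive_Reals; rewrite /barrier_D /barrier_D2 /vscal.
  have E (s : R) : (al + al' * t) * (2 * b) *
     (jpow (b - 1) (vadd x (vscal s (basis i))) * (vadd x (vscal s (basis i)) j - z j)) =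
     (al + al' * t) * (2 * b * jpow (b - 1) (vadd x (vscal s (basis i)))) *
     vsub (vadd x (vscal s (basis i))) z j by rewrite /vsub; ring.
  apply: (is_derive_ext _ _ _ _ E).
  apply: (is_derive_eq _ _ _ _ (is_derive_scal _ _ _ _ (is_derive_mult _ _ _ _ _
    (is_derive_jpow (b - 1) x i) (is_derive_basis i j x) Rmult_comm))).
  have -> : b - 2 = b - 1 - 1 by lra.
  have x0 : vadd x (vscal 0 (basis i)) j = x j by rewrite /vadd /vscal; ring.
  have E0 : jpow (b - 1) (vadd x (vscal 0 (basis i))) = jpow (b - 1) x.
    by rewrite /jpow vsq_line; congr Rpower; ring.
  by rewrite /mult /plus /= x0 E0 /vsub; ring.
- apply: jcont_plus; first exact: jcont_mult.
  by apply: jcont_plus => //; apply: jcont_scal; exact: jcont_time.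
- by apply: jcont_plus; [apply: jcont_scal | apply: jcont_plus => //; apply: jcont_scal].
- move=> i; apply: jcont_mult => //; apply: jcont_mult => //.
  by apply: jcont_scal.
- move=> i j; apply: jcont_plus; apply: jcont_mult.
  + by apply: jcont_mult => //; apply: jcont_scal.
  + exact: jcont_const.
  + by apply: jcont_mult => //; do 2! apply: jcont_scal.
  + exact: jcont_mult.
Qed.
End Barrier.

(** * Inequalities for powers, and the bound on [H] for radial functions *)

Lemma Rpower_anti D p q : 0 < D <= 1 -> q <= p -> Rpower D p <= Rpower D q.
Proof.
move=> [D0 D1] qp; have lnD : ln D <= 0 by rewrite -ln_1; apply: ln_le.
have : p * ln D <= q * ln D by nra.
by rewrite /Rpower => -[/exp_increasing|->]; lra.
Qed.

Lemma Rpower_small p c : 0 < p -> 0 < c ->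
  exists d, 0 < d <= 1 /\ forall D, 0 < D <= d -> Rpower D p <= c.
Proof.
move=> p0 c0; exists (Rmin 1 (Rpower c (/ p))).
split; first by split; [apply: Rmin_pos; [lra | exact: Rpower_gt0] | exact: Rmin_l].
move=> D [D0 Dd]; have : Rpower D p <= Rpower (Rpower c (/ p)) p.
  apply: Rle_Rpower_l; first lra.
  by split=> //; apply: Rle_trans Dd (Rmin_r _ _).
have p_neq0 : p <> 0 by lra.
by rewrite Rpower_mult Rinv_l // Rpower_1.
Qed.

Lemma rpow_Rpower a b : 0 < a -> rpow a b = Rpower a b.
Proof. by move=> a0; rewrite /rpow; case: Req_EM_T => [?|//] /=; lra. Qed.

Lemma rpow_le a b c : 0 < b -> 0 <= a <= c -> 0 < c -> rpow a b <= Rpower c b.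
Proof.
move=> b0 [a0 ac] c0; have := Rpower_gt0 c b => ?.
rewrite /rpow; case: Req_EM_T => ? /=.
  by case: Req_EM_T => ? /=; lra.
by apply: Rle_Rpower_l; lra.
Qed.

Lemma midC n (i j : 'I_n) : mid i j = mid j i.
Proof. by rewrite /mid eq_sym. Qed.

(* The bound does not depend on [c]: the rank-one term is absorbed by the
   parameter [lambda] of [Lambda^sup], hence so is [Z(u) Du (x) Du]. *)
Lemma radial_bound n (H : vecn n -> matn n -> R) k1 Lam (y : vecn n) (X : matn n) a c w :
  condB H k1 -> 0 < k1 -> 0 <= Lam ->
  (forall lambda e, unit_vec e -> H e (madd (mscal lambda (outer e e)) (@mid n)) <= Lam) ->
  0 < a -> vnorm y <= w -> 0 < w ->
  (forall i j, X i j = a * mid i j + c * (y i * y j)) ->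
  H (vscal a y) X <= Lam * (a * Rpower (a * w) k1).
Proof.
move=> [_ [Hq HX]] k1_0 Lam0 HLam a0 yw w0 XE.
have Xsym : Defs.symmetric X by move=> i j; rewrite !XE midC; ring.
have P0 := Rpower_gt0 (a * w) k1.
(* At the centre the gradient vanishes, and homogeneity with [k1 > 0] makes [H] zero there. *)
have [y0|yn0] := Req_dec (vnorm y) 0.
  have -> : vscal a y = vscal 0 y.
    apply: functional_extensionality => i; rewrite /vscal.
    have := coord_le_vnorm n y i; rewrite y0 => /Rabs_le_between ?.
    have -> : y i = 0 by lra.
    by ring.
  rewrite Hq // Rabs_R0 /rpow; case: Req_EM_T => // ? /=.
  case: Req_EM_T => [?|?] /=; first lra.
  by rewrite Rmult_0_l; apply: Rmult_le_pos => //; nra.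
have r0 : 0 < vnorm y by have := vnorm_ge0 n y; lra.
set r := vnorm y in yw yn0 r0.
pose e := vscal (/ r) y.
have e1 : unit_vec e.
  rewrite /unit_vec /e vnorm_scal -/r; first by field.
  by left; exact: Rinv_0_lt_compat.
(* With [y = r e], the matrix [X = a I + c r^2 e (x) e] is [a] times this one, to which the bound
   [Lam] applies. *)
pose Y := madd (mscal (c * (r * r) / a) (outer e e)) (@mid n).
have Ysym : Defs.symmetric Y.
  by move=> i j; rewrite /Y /madd /mscal /outer midC; ring.
have -> : vscal a y = vscal (a * r) e.
  by apply: functional_extensionality => i; rewrite /e /vscal; field.
have -> : X = mscal a Y.
  do 2! apply: functional_extensionality => ?.
  by rewrite XE /Y /madd /mscal /outer /e /vscal; field; lra.
have ar0 : 0 < a * r by exact: Rmult_lt_0_compat.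
have sX : Defs.symmetric (mscal a Y) by move=> i j; rewrite /mscal Ysym.
rewrite Hq // Rabs_right; last by lra.
rewrite HX // rpow_Rpower //.
have PP : Rpower (a * r) k1 <= Rpower (a * w) k1.
  by apply: Rle_Rpower_l; [lra | split=> //; nra].
have := HLam (c * (r * r) / a) e e1; rewrite -/Y => HY.
apply: (Rle_trans _ (Rpower (a * r) k1 * (a * Lam))).
  by apply: Rmult_le_compat_l; [have := Rpower_gt0 (a * r) k1; lra | nra].
rewrite Rmult_comm (Rmult_comm a) Rmult_assoc; apply: Rmult_le_compat_l => //.
by apply: Rmult_le_compat_l; lra.
Qed.

(** * Comparison with the barrier *)

Section Comparison.

Variables (n : nat) (H : vecn n -> matn n -> R) (k1 T : R) (chi : R -> R)
  (sigma : R) (Z : R -> R) (u : vecn n -> R -> R) (z : vecn n)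
  (beta q kappa Sh Lam : R).

Hypothesis HB : condB H k1.
Hypothesis k1_gt0 : 0 < k1.
Hypothesis Lam_ge0 : 0 <= Lam.
Hypothesis HLam : forall lambda e, unit_vec e ->
  H e (madd (mscal lambda (outer e e)) (@mid n)) <= Lam.
Hypothesis T_gt0 : 0 < T.
Hypothesis u_usc : usc_on T u.
Hypothesis u_sub : visc_subsol H Z chi sigma T u.
Hypothesis u_init : forall x, u x 0 <= Sh.
Hypothesis u_growth : forall eps, 0 < eps -> exists R0, 0 < R0 /\
  forall R, R0 <= R -> exists S,
    is_lub (fun y => exists x t, vnorm (vsub x z) <= R /\ 0 < t < T /\ y = u x t) S
    /\ Rabs S <= eps * Rpower R beta.
Hypothesis beta_gt0 : 0 < beta.
(** For an amplitude [D <= 1], [q > 1] makes [D^q] negligible against [D], and [q <= k1 + 1] lets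
    the power [D^(k1 + 1)] coming from [H] be replaced by [D^q]. The bound on [(beta - 1) k1] keeps
    the spatial growth of the [H] term within that of [g]. *)
Hypothesis q_gt1 : 1 < q.
Hypothesis q_le : q <= k1 + 1.
Hypothesis beta_k1 : (beta - 1) * k1 <= 2.
Hypothesis kappa_ge0 : 0 <= kappa.
(** The common form of all ranges of [sigma]. Here [D] stands for [A beta], [s] for [1 + |x - z|^2]
    and [P] for the length of the barrier's gradient. *)
Hypothesis chi_bound : forall eta, 0 < eta -> exists C, 0 <= C /\
  forall t D s P, 0 < t < T -> 0 < D <= 1 -> 1 <= s ->
    0 <= P <= D * Rpower s ((beta - 1) / 2) ->
    chi t * rpow P sigma <= kappa + eta + C * (Rpower D q * Rpower s (beta / 2)).

Let g := jpow n z (beta / 2).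

Lemma jpow_ge_Rpower x r : 0 < r <= vnorm (vsub x z) -> Rpower r beta <= g x.
Proof.
move=> [r0 rx].
have -> : Rpower r beta = Rpower (r * r) (beta / 2).
  by rewrite -Rpower_mult_distr // -Rpower_plus; congr Rpower; lra.
apply: Rle_Rpower_l; first lra.
by rewrite -vnorm_sqr; split; nra.
Qed.

(** Inside radius [R0] the supremum over that one ball gives the constant; farther out the growth
    condition is used with the radius [|x - z|] itself. *)
Lemma subsol_growth eps : 0 < eps ->
  exists K, 0 < K /\ forall x t, 0 < t < T -> u x t <= K + eps * g x.
Proof.
move=> eps0; have [R0 [R00 HR]] := u_growth eps eps0.
have P0 := Rpower_gt0 R0 beta.
exists (eps * Rpower R0 beta); split=> [|x t tT]; first by nra.
have g0 : 0 < g x := Rpower_gt0 _ _.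
have [xR|Rx] := Rle_lt_dec (vnorm (vsub x z)) R0.
  have [S [[Sub _] SR]] := HR R0 (Rle_refl _).
  have uS : u x t <= S by apply: Sub; exists x, t.
  by have := Rle_abs S; nra.
have [S [[Sub _] SR]] := HR (vnorm (vsub x z)) (Rlt_le _ _ Rx).
have uS : u x t <= S by apply: Sub; exists x, t; split=> //; exact: Rle_refl.
have := jpow_ge_Rpower x (vnorm (vsub x z)) ltac:(lra).
by have := Rle_abs S; nra.
Qed.

Lemma vnorm_le_Rpower (y : vecn n) : vnorm y <= Rpower (1 + vsq n y) (/ 2).
Proof.
have ? := vsq_ge0 n y; rewrite Rpower_sqrt; last lra.
by apply: sqrt_le_1_alt; rewrite -/(vsq n y); lra.
Qed.

Lemma vnorm_barrier_D al al' x t :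
  let A := al + al' * t in 0 < A ->
  vnorm (barrier_D n z (beta / 2) al al' x t) <=
  A * beta * Rpower (1 + vsq n (vsub x z)) ((beta - 1) / 2).
Proof.
move=> A A0; rewrite /barrier_D -/A /jpow.
set s := 1 + _; have P0 := Rpower_gt0 s (beta / 2 - 1).
have AP : 0 < A * beta * Rpower s (beta / 2 - 1) by repeat apply: Rmult_lt_0_compat.
have -> : A * (2 * (beta / 2) * Rpower s (beta / 2 - 1)) =
  A * beta * Rpower s (beta / 2 - 1) by field.
rewrite vnorm_scal; last by lra.
have -> : (beta - 1) / 2 = (beta / 2 - 1) + / 2 by field.
rewrite Rpower_plus -Rmult_assoc; apply: Rmult_le_compat_l; first by lra.
exact: vnorm_le_Rpower.
Qed.

(** The term [Z(r) p (x) p] only changes the rank-one coefficient, so [radial_bound] applies with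
    [w = s^(1/2)]. It yields [(A beta)^(k1 + 1)] times a power of [s]; the exponents are then
    relaxed using [A beta <= 1] and [s >= 1]. *)
Lemma Psigma_barrier al al' a x t r :
  let A := al + al' * t in 0 < A -> A * beta <= 1 ->
  Psigma H Z chi sigma t r a (barrier_D n z (beta / 2) al al' x t)
     (barrier_D2 n z (beta / 2) al al' x t) <=
  Lam * (Rpower (A * beta) q * g x) +
  chi t * rpow (vnorm (barrier_D n z (beta / 2) al al' x t)) sigma - a.
Proof.
move=> A A0 Ab; have D0 : 0 < A * beta by exact: Rmult_lt_0_compat.
set p := barrier_D _ _ _ _ _ _ _; rewrite /Psigma.
suff : H p (madd (barrier_D2 n z (beta / 2) al al' x t) (mscal (Z r) (outer p p))) <=
    Lam * (Rpower (A * beta) q * g x) by lra.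
rewrite /p /barrier_D; set y := vsub x z; rewrite -/A.
set c := A * (2 * (beta / 2) * jpow n z (beta / 2 - 1) x).
pose s := 1 + vsq n y; have q0 : 0 <= vsq n y := vsq_ge0 n y.
have cE : c = A * beta * Rpower s (beta / 2 - 1) by rewrite /c /jpow -/y -/s; field.
have c0 : 0 < c by rewrite cE; apply: Rmult_lt_0_compat => //; exact: Rpower_gt0.
apply: Rle_trans (radial_bound n H k1 Lam y _ c
  (A * (2 * (beta / 2) * (2 * (beta / 2 - 1) * jpow n z (beta / 2 - 2) x)) + Z r * c * c)
  (Rpower s (/ 2)) HB k1_gt0 Lam_ge0 HLam c0 (vnorm_le_Rpower y) (Rpower_gt0 _ _) _) _.
  move=> i j; rewrite /barrier_D2 /madd /mscal /outer /vscal -/y -/A -/c; ring.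
apply: Rmult_le_compat_l => //.
have -> : c * Rpower s (/ 2) = A * beta * Rpower s (beta / 2 - / 2).
  rewrite cE Rmult_assoc -Rpower_plus; do 2! f_equal; field.
rewrite -Rpower_mult_distr // ?Rpower_mult; last exact: Rpower_gt0.
have -> : c * (Rpower (A * beta) k1 * Rpower s ((beta / 2 - / 2) * k1)) =
  Rpower (A * beta) (k1 + 1) * Rpower s (beta / 2 - 1 + (beta / 2 - / 2) * k1).
  by rewrite cE !Rpower_plus (Rpower_1 (A * beta)) //; ring.
apply: Rmult_le_compat; try by apply: Rlt_le; exact: Rpower_gt0.
  exact: Rpower_anti.
by apply: Rle_Rpower; rewrite /s; lra.
Qed.

Lemma comparison x t : 0 < t < T -> u x t <= Sh + kappa * t.
Proof.
move=> tT; apply: Rnot_lt_le => gap.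
set d := u x t - (Sh + kappa * t).
have d0 : 0 < d by rewrite /d; lra.
(* The excess [d] is split into quarters: [eta t], the spatial term at [(x, t)] and the exponential
   at [t] each get at most [d / 4]. *)
pose eta := d / (4 * T).
have eta0 : 0 < eta by apply: Rdiv_lt_0_compat; lra.
have etat : eta * t <= d / 4.
  have -> : d / 4 = eta * T by rewrite /eta; field; lra.
  by apply: Rmult_le_compat_l; lra.
have [C [C0 HC]] := chi_bound eta eta0.
have gx0 : 0 < g x := Rpower_gt0 _ _.
(* Chosen so that [D <= 2 al beta <= d0'] gives [(C + Lam) D^q <= al / T], the growth rate of the
   amplitude. *)
have [d0' [d0'01 Hd0']] := Rpower_small (q - 1) (/ (2 * beta * T * (C + Lam + 1)))
  ltac:(lra) ltac:(apply: Rinv_0_lt_compat; repeat apply: Rmult_lt_0_compat; lra).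
(* Since [A <= 2 al], the first bound gives [A beta <= d0'] and the second gives
   [A g(x) <= d / 4]. *)
pose al := Rmin (d0' / (2 * beta)) (d / (8 * g x)).
have al0 : 0 < al by apply: Rmin_pos; apply: Rdiv_lt_0_compat; lra.
have al1 : 2 * al * beta <= d0'.
  have -> : d0' = 2 * (d0' / (2 * beta)) * beta by field; lra.
  by have := Rmin_l (d0' / (2 * beta)) (d / (8 * g x)); rewrite -/al; nra.
have al2 : al * g x <= d / 8.
  have -> : d / 8 = d / (8 * g x) * g x by field; lra.
  by apply: Rmult_le_compat_r; [lra | exact: Rmin_r].
(* Half of the spatial term absorbs the growth of [u]; the other half remains to beat [K - Sh] far
   from [z]. *)
have [K [K0 HK]] := subsol_growth (al / 2) ltac:(lra).
pose T1 := (t + T) / 2; pose T2 := (T1 + T) / 2.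
(* By [exp r >= 1 + r], the first summand makes the exponential at least [K - Sh] from [T2] on, and
   the second makes it at most [d / 4] at time [t]. *)
pose N := (Rabs (K - Sh) + 1) / (T2 - T1) + 4 / (d * (T1 - t)).
have dT : 0 < d * (T1 - t) by apply: Rmult_lt_0_compat; rewrite /T1; lra.
have N1 : 0 < (Rabs (K - Sh) + 1) / (T2 - T1).
  by apply: Rdiv_lt_0_compat; [have := Rabs_pos (K - Sh) | rewrite /T2 /T1]; lra.
have N2 : 0 < 4 / (d * (T1 - t)) by apply: Rdiv_lt_0_compat; lra.
have N0 : 0 < N by rewrite /N; lra.
have late s : T2 <= s -> K - Sh <= exp (N * (s - T1)).
  move=> T2s; apply: Rle_trans (exp_ineq1_le _).
  have E : Rabs (K - Sh) + 1 = (Rabs (K - Sh) + 1) / (T2 - T1) * (T2 - T1).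
    by field; rewrite /T2 /T1; lra.
  have T21 : 0 < T2 - T1 by rewrite /T2 /T1; lra.
  have := Rle_abs (K - Sh) => ?.
  suff : (Rabs (K - Sh) + 1) / (T2 - T1) * (T2 - T1) <= N * (s - T1) by lra.
  by apply: Rmult_le_compat; rewrite /N; lra.
have early : exp (N * (t - T1)) <= d / 4.
  have E : 4 / d <= N * (T1 - t).
    have -> : 4 / d = 4 / (d * (T1 - t)) * (T1 - t) by field; rewrite /T1; lra.
    have ? : 0 < T1 - t by rewrite /T1; lra.
    by apply: Rmult_le_compat_r; rewrite /N; lra.
  have -> : N * (t - T1) = - (N * (T1 - t)) by ring.
  have -> : d / 4 = / (4 / d) by field; lra.
  rewrite exp_Ropp; apply: Rinv_le_contravar; first by apply: Rdiv_lt_0_compat; lra.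
  by have := exp_ineq1_le (N * (T1 - t)); lra.
pose Psi := barrier n z (beta / 2) al (al / T) (kappa + eta) N T1.
have PsiE y s : Psi y s = al * (1 + s / T) * g y + ((kappa + eta) * s + exp (N * (s - T1))).
  by rewrite /Psi /barrier -/g; field; lra.
have Psi_ge y s : 0 <= s -> al * g y + exp (N * (s - T1)) <= Psi y s.
  move=> s0; rewrite PsiE; have ? : 0 < g y := Rpower_gt0 _ _.
  have ? : 0 <= s / T by apply: Rdiv_le_0_compat.
  have : 0 <= (al * g y) * (s / T) by apply: Rmult_le_pos => //; nra.
  have : 0 <= (kappa + eta) * s by apply: Rmult_le_pos; lra.
  by lra.
have [B [xB HBig]] : exists B, vnorm (vsub x z) <= B /\
    forall y, B < vnorm (vsub y z) -> K - Sh <= al / 2 * g y.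
  pose v := Rmax 1 ((K - Sh) / (al / 2)).
  exists (Rmax (vnorm (vsub x z)) (Rpower v (/ beta))); split=> [|y By].
    exact: Rmax_l.
  have r0 := Rpower_gt0 v (/ beta).
  have rB := Rmax_r (vnorm (vsub x z)) (Rpower v (/ beta)).
  have := jpow_ge_Rpower y (Rpower v (/ beta)) ltac:(lra).
  have v1 : 1 <= v by exact: Rmax_l.
  rewrite Rpower_mult Rinv_l ?Rpower_1; try by lra.
  move=> vg; have -> : K - Sh = al / 2 * ((K - Sh) / (al / 2)) by field; lra.
  apply: Rmult_le_compat_l; first lra.
  by apply: Rle_trans vg; exact: Rmax_r.
have T12 : t < T1 < T2 /\ T2 < T by rewrite /T2 /T1; lra.
(* Far from [z] the spatial term wins, late in time the exponential does, and at time 0 the initial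
   bound suffices. *)
have outside y s : 0 <= s < T -> B < vnorm (vsub y z) \/ T2 <= s \/ s = 0 ->
    u y s - Psi y s <= Sh.
  move=> sT; have gy0 : 0 < g y := Rpower_gt0 _ _.
  have PsiK := Psi_ge y s (proj1 sT); have e0 := exp_pos (N * (s - T1)).
  have ag0 : 0 < al * g y by exact: Rmult_lt_0_compat.
  have [s0|s0] := Req_dec s 0.
    by move=> _; rewrite s0 in PsiK e0 *; have := u_init y; lra.
  have uK := HK y s ltac:(lra).
  by case=> [/HBig ?|[/late ?|//]]; lra.
have inside : u x t - Psi x t > Sh.
  have tT1 : t / T <= 1 by apply/Rle_div_l; lra.
  have agx : 0 < al * g x by exact: Rmult_lt_0_compat.
  have ? : al * (1 + t / T) * g x <= d / 4.
    have -> : al * (1 + t / T) * g x = al * g x + al * g x * (t / T) by ring.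
    by nra.
  have ? : u x t = Sh + kappa * t + d by rewrite /d; ring.
  by rewrite PsiE; lra.
have [x0 [t0 [t0T2 Hmax]]] := usc_max_on_cylinder n T T2 B u Psi z x t
  ltac:(lra) u_usc (proj1 (proj2 (proj2 (proj2 (barrier_C21 _ _ _ _ _ _ _ _))))) xB ltac:(lra).
have max_gt : Sh < u x0 t0 - Psi x0 t0 by have := Hmax x t xB ltac:(lra); lra.
have t00 : 0 < t0.
  apply: Rnot_le_lt => t0le; have E : t0 = 0 by lra.
  by have := outside x0 t0 ltac:(lra) ltac:(tauto); lra.
have t0T : 0 < t0 < T by lra.
(* Outside the cylinder the difference is at most [Sh], which the maximum exceeds, so the maximum is
   global and the test radius below can be any number. *)
have Hglob y s : 0 < s < T -> u y s - Psi y s <= u x0 t0 - Psi x0 t0.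
  move=> sT; have [yB|By] := Rle_lt_dec (vnorm (vsub y z)) B; last first.
    by have := outside y s ltac:(lra) ltac:(tauto); lra.
  have [sT2|T2s] := Rle_lt_dec s T2; first by apply: Hmax => //; lra.
  by have := outside y s ltac:(lra) ltac:(right; left; lra); lra.
have := u_sub _ _ _ _ x0 t0 (barrier_C21 n z (beta / 2) al (al / T) (kappa + eta) N T1) t0T
  (ex_intro _ 1 (conj Rlt_0_1 (fun y s _ _ => Hglob y s))).
pose A := al + al / T * t0.
have AE : A = al * (1 + t0 / T) by rewrite /A; field; lra.
have t0T1 : 0 < t0 / T < 1.
  by split; [apply: Rdiv_lt_0_compat | apply/Rlt_div_l]; lra.
have A0 : 0 < A by rewrite AE; nra.
have A2 : A <= 2 * al by rewrite AE; nra.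
have D0 : 0 < A * beta by exact: Rmult_lt_0_compat.
have Dd : A * beta <= d0' by nra.
have D1 : A * beta <= 1 by lra.
move=> /Rle_trans /(_ (Psigma_barrier _ _ _ _ _ _ A0 D1)).
rewrite -/A.
have s1 : 1 <= 1 + vsq n (vsub x0 z) by have := vsq_ge0 n (vsub x0 z); lra.
have := HC t0 (A * beta) _ _ t0T (conj D0 D1) s1
  (conj (vnorm_ge0 _ _) (vnorm_barrier_D al (al / T) x0 t0 A0)).
rewrite /barrier_t -/(jpow n z (beta / 2) x0) -/(g x0).
set G := g x0; have G0 : 0 < G := Rpower_gt0 _ _.
have e0 : 0 < N * exp (N * (t0 - T1)) by apply: Rmult_lt_0_compat => //; exact: exp_pos.
(* The time derivative of the amplitude then dominates the [H] and [chi] terms and [kappa + eta]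
   cancels, leaving [N exp(N (t0 - T1)) <= 0], which is absurd. *)
have key : (C + Lam) * Rpower (A * beta) q <= al / T.
  have -> : al / T = (C + Lam + 1) *
      (2 * al * beta * / (2 * beta * T * (C + Lam + 1))) by field; lra.
  have Dq := Rlt_le _ _ (Rpower_gt0 (A * beta) q).
  apply: Rmult_le_compat => //; try lra.
  rewrite (Rpower_pred (A * beta)) //; apply: Rmult_le_compat; try lra.
  - exact: Rlt_le _ _ (Rpower_gt0 _ _).
  - by nra.
  - by apply: Hd0'; lra.
have : (C + Lam) * Rpower (A * beta) q * G <= al / T * G by apply: Rmult_le_compat_r; lra.
by lra.
Qed.
End Comparison.

(** * Interpolation of powers and the ranges of [sigma] *)

(** Rescale by a [y0] with [M y0^theta <= eta] and use [r^theta <= 1 + r]. The constant term can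
    thus be made as small as desired, which is why [kappa = 0] is possible for [sigma > 0]. *)
Lemma Rpower_le_affine theta M eta : 0 < theta <= 1 -> 0 <= M -> 0 < eta ->
  exists C, 0 <= C /\ forall Y, 0 < Y -> M * Rpower Y theta <= eta + C * Y.
Proof.
move=> [th0 th1] M0 eta0.
(* Dividing by [M + 1] instead of [M] also covers [M = 0]. *)
pose y0 := Rpower (eta / (M + 1)) (/ theta).
have y00 : 0 < y0 := Rpower_gt0 _ _.
have eM0 : 0 < eta / (M + 1) by apply: Rdiv_lt_0_compat; lra.
have y0th : Rpower y0 theta = eta / (M + 1).
  by rewrite /y0 Rpower_mult Rinv_l ?Rpower_1 //; lra.
have My0 : M * Rpower y0 theta <= eta.
  rewrite y0th; have {2}-> : eta = (M + 1) * (eta / (M + 1)) by field; lra.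
  by apply: Rmult_le_compat_r; lra.
exists (eta / y0); split=> [|Y Y0]; first by apply: Rlt_le; apply: Rdiv_lt_0_compat.
have Yy0 : 0 < Y / y0 by apply: Rdiv_lt_0_compat.
have Y_le : Rpower (Y / y0) theta <= 1 + Y / y0.
  have [le1|gt1] := Rle_lt_dec (Y / y0) 1.
    have := Rle_Rpower_l (Y / y0) 1 theta ltac:(lra) (conj Yy0 le1).
    by rewrite {2}/Rpower ln_1 Rmult_0_r exp_0; lra.
  have := Rle_Rpower (Y / y0) theta 1 ltac:(lra) th1.
  by rewrite Rpower_1 //; lra.
have -> : Y = y0 * (Y / y0) by field; lra.
rewrite -Rpower_mult_distr //.
have -> : eta + eta / y0 * (y0 * (Y / y0)) = eta * (1 + Y / y0) by field; lra.
rewrite -Rmult_assoc; apply: Rmult_le_compat => //.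
  by apply: Rmult_le_pos => //; exact: Rlt_le _ _ (Rpower_gt0 _ _).
exact: Rlt_le _ _ (Rpower_gt0 _ _).
Qed.

Lemma rpow_0 a : 0 <= a -> rpow a 0 = 1.
Proof.
move=> a0; rewrite /rpow; case: Req_EM_T => ? /=.
  by case: Req_EM_T => ? /=; lra.
by apply: Rpower_O; lra.
Qed.

Theorem theorem2p6 (n : nat) (H : vecn n -> matn n -> R) (k1 : R)
  (T : R) (h : vecn n -> R) (chi : R -> R) (sigma m : R) (Z : R -> R)
  (u : vecn n -> R -> R) (z : vecn n) (beta : R) :
  (2 <= n)%nat ->
  H_continuous H -> condA H -> condB H k1 -> condC H ->
  1 < k1 + 1 ->
  0 < T ->
  (forall x eps, 0 < eps -> exists delta, 0 < delta /\
     forall y, vnorm (vsub y x) < delta -> Rabs (h y - h x) < eps) ->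
  (exists M, forall x, h x <= M) ->
  (exists C, forall t, 0 < t < T -> Rabs (chi t) <= C) ->
  (forall t, 0 < t < T -> continuity_pt chi t) ->
  0 <= sigma ->
  (forall r s, m <= r -> r <= s -> Z s <= Z r) ->
  (forall r, m <= r -> 0 <= Z r) ->
  (forall r, m <= r -> forall eps, 0 < eps -> exists delta, 0 < delta /\
     forall s, m <= s -> Rabs (s - r) < delta -> Rabs (Z s - Z r) < eps) ->
  usc_on T u ->
  (exists c, m < c /\ forall x t, 0 <= t < T -> c <= u x t) ->
  visc_subsol H Z chi sigma T u ->
  (forall x, u x 0 <= h x) ->
  (* sup_{B^R_T} u = o(R^beta) as R -> infinity *)
  (forall eps, 0 < eps -> exists R0, 0 < R0 /\ forall R, R0 <= R ->
     exists S, is_lub (fun y => exists x t, vnorm (vsub x z) <= R /\ 0 < t < T /\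
                                 y = u x t) S
               /\ Rabs S <= eps * Rpower R beta) ->
  forall Sh Schi,
    is_lub (fun y => exists x, y = h x) Sh ->
    is_lub (fun y => exists t, 0 < t < T /\ y = Rabs (chi t)) Schi ->
    let k := k1 + 1 in
    let gamma := k + 1 in
    let gamma_star := gamma / (gamma - 2) in
    let sigma_star := sigma / (sigma - 1) in
    (* (a) *)
    (0 <= sigma <= gamma / 2 -> beta = gamma_star ->
       (sigma = 0 -> forall x t, 0 < t < T -> u x t <= Sh + t * Schi) /\
       (0 < sigma -> forall x t, 0 < t < T -> u x t <= Sh)) /\
    (* (b) *)
    (gamma / 2 < sigma -> beta = sigma_star ->
       forall x t, 0 < t < T -> u x t <= Sh).
Proof.
move=> _ _ _ HB [_ [_ [L HL]]] k1gt T0 _ _ [M chiM] _ _ _ _ _ usc_u _ sub_u uh growth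
  Sh Schi [Sh_ub _] [Schi_ub _] k gamma gamma_star sigma_star.
have k1_0 : 0 < k1 by lra.
(* The maximum with 0 supplies a nonnegative bound for [Lambda^sup]. *)
have HLam lambda e : unit_vec e ->
    H e (madd (mscal lambda (outer e e)) (@mid n)) <= Rmax L 0.
  by move=> /HL /Rle_trans; apply; exact: Rmax_l.
have u0 x : u x 0 <= Sh by apply: Rle_trans (uh x) _; apply: Sh_ub; exists x.
have T2 : 0 < T / 2 < T by lra.
have M0 : 0 <= M by have := chiM _ T2; have := Rabs_pos (chi (T / 2)); lra.
have Schi0 : 0 <= Schi.
  by apply: Rle_trans (Rabs_pos (chi (T / 2))) _; apply: Schi_ub; exists (T / 2).
pose q := k1 / 2 + 1.
have gammaE : gamma / 2 = q by rewrite /gamma /k /q; field.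
have compare kappa := comparison n H k1 T chi sigma Z u z beta q kappa Sh (Rmax L 0)
  HB k1_0 (Rmax_r L 0) HLam T0 usc_u sub_u u0 growth.
have q1 : 1 < q by rewrite /q; lra.
have qk : q <= k1 + 1 by rewrite /q; lra.
have chi_le t D s P : 0 < t < T -> 0 < sigma -> 0 < D ->
    0 <= P <= D * Rpower s ((beta - 1) / 2) ->
    chi t * rpow P sigma <= M * (Rpower D sigma * Rpower s ((beta - 1) / 2 * sigma)).
  move=> tT sig0 D0 PD; have s0 := Rpower_gt0 s ((beta - 1) / 2).
  have Ds0 : 0 < D * Rpower s ((beta - 1) / 2) by exact: Rmult_lt_0_compat.
  have := rpow_le P sigma _ sig0 PD Ds0.
  rewrite -Rpower_mult_distr // Rpower_mult => rP.
  have r0 : 0 <= rpow P sigma.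
    rewrite /rpow; case: Req_EM_T => ? /=; last exact: Rlt_le _ _ (Rpower_gt0 _ _).
    by case: Req_EM_T => ? /=; lra.
  apply: Rle_trans (Rmult_le_compat_l _ _ _ M0 rP).
  apply: Rmult_le_compat_r => //.
  exact: Rle_trans (Rle_abs _) (chiM t tT).
split=> [sig_le betaE|sig_gt betaE x t tT].
  have beta0 : 0 < beta.
    by rewrite betaE /gamma_star /gamma /k; apply: Rdiv_lt_0_compat; lra.
  (* Here [gamma - 2 = k1], so [beta - 1 = 2 / k1]; equivalently [beta = (beta - 1) q]. *)
  have bk : (beta - 1) * k1 = 2.
    by rewrite betaE /gamma_star /gamma /k; field; lra.
  have bk2 : (beta - 1) * k1 <= 2 by lra.
  split=> [sig0 x t tT|sig0 x t tT].
    rewrite (Rmult_comm t); apply: (compare Schi) => // eta eta0.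
    (* For [sigma = 0] the [chi] term is just [chi], paid for entirely by [kappa = Schi]. *)
    exists 0; split=> [|t' D s P tT' _ _ [P0 _]]; first exact: Rle_refl.
    rewrite sig0 rpow_0 // Rmult_1_r Rmult_0_l.
    have : Rabs (chi t') <= Schi by apply: Schi_ub; exists t'.
    by have := Rle_abs (chi t'); lra.
  rewrite -(Rplus_0_r Sh) -(Rmult_0_l t).
  apply: (compare 0) => // [|eta eta0]; first exact: Rle_refl.
  have th01 : 0 < sigma / q <= 1.
    by split; [apply: Rdiv_lt_0_compat | apply/Rle_div_l]; lra.
  (* Applied to [Y = D^q s^(beta/2)]: as [beta = (beta - 1) q], the [chi] term is at most
     [M Y^(sigma/q)]. *)
  have [C [C0 HC]] := Rpower_le_affine (sigma / q) M eta th01 M0 eta0.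
  exists C; split=> // t' D s P tT' [D0 _] s1 PD; rewrite Rplus_0_l.
  apply: Rle_trans (chi_le _ _ _ _ tT' sig0 D0 PD) _.
  apply: Rle_trans (HC _ (Rmult_lt_0_compat _ _ (Rpower_gt0 D q) (Rpower_gt0 s (beta / 2)))).
  rewrite -Rpower_mult_distr; try exact: Rpower_gt0.
  rewrite !Rpower_mult; apply: Req_le; do 3! f_equal; first by field; lra.
  have bq : beta = (beta - 1) * q by rewrite /q; lra.
  by rewrite {2}bq; field; lra.
have sig0 : 0 < sigma by lra.
have beta0 : 0 < beta by rewrite betaE; apply: Rdiv_lt_0_compat; lra.
have bs : (beta - 1) * (sigma - 1) = 1 by rewrite betaE /sigma_star; field; lra.
have b1 : 0 < beta - 1 by nra.
have bk : (beta - 1) * k1 <= 2 by rewrite /q in gammaE; nra.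
rewrite -(Rplus_0_r Sh) -(Rmult_0_l t).
apply: (compare 0) => // [|eta eta0]; first exact: Rle_refl.
(* For [beta = sigma / (sigma - 1)] the power of [s] is exactly [beta / 2], and [D^sigma <= D^q]
   because [D <= 1] and [q < sigma]. *)
exists M; split=> // t' D s P tT' D01 s1 PD.
have D0 := proj1 D01.
apply: Rle_trans (chi_le _ _ _ _ tT' sig0 D0 PD) _.
have -> : (beta - 1) / 2 * sigma = beta / 2 by lra.
have : M * (Rpower D sigma * Rpower s (beta / 2)) <=
    M * (Rpower D q * Rpower s (beta / 2)); last by lra.
apply: Rmult_le_compat_l => //; apply: Rmult_le_compat_r.
  exact: Rlt_le _ _ (Rpower_gt0 _ _).
by apply: Rpower_anti => //; lra.
Qed.
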